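(* The operator $\mathcal{S}_{\mathrm{ref}\,1/4}$ (the convolution operator $\mathcal{S}_{\mathrm{ref}\,\theta}$ given in the context, taken with $\theta=\frac14$) is independent of $h$, since its parameters are $$c_{0\,1/4}=-\left(\frac{|\hat a|}{2}\right)^{1/2}e^{-i(\arg_0\hat a)/2},\qquad \varkappa_{1/4}=-e^{i\arg\hat a},\qquad \mu_{1/4}=\frac{\hat a_0}{|\hat a|}.$$
   Context: Let $h,\tau,\hbar,\rho_\infty,B_\infty>0$, $V_\infty\in\mathbb{R}$ and real $\theta\leq\frac14$. For $z\in\mathbb{C}\setminus\{0\}$, $\arg z$ is defined up to $2\pi k$ with any integer $k$, whereas $\arg_0z\in[0,2\pi)$. Put $$\hat a=\hat a_0+i\hat a_1,\quad \hat a_0=\frac{V_\infty}{\hbar^2B_\infty},\quad \hat a_1=\frac{2\rho_\infty}{\tau\hbar B_\infty}>0$$ (these do not depend on $h$), $$\hat\alpha_\theta=2\hat a+(1-4\theta)h^2\hat a^2\neq0,\qquad \hat\beta_\theta=2\hat a_0+(1-4\theta)h^2|\hat a|^2,$$ $$c_{0\theta}=-\frac{|\hat\alpha_\theta|^{1/2}}{2}e^{-i(\arg_0\hat\alpha_\theta)/2},\qquad \varkappa_\theta=-e^{i\arg\hat\alpha_\theta},\qquad \mu_\theta=\frac{\hat\beta_\theta}{|\hat\alpha_\theta|}.$$ With the Legendre polynomials $P_m$ extended by $P_m=0$ for $m<0$, let $R^m(\varkappa,\mu)=-\frac{\varkappa^m}{2m-1}[P_m(\mu)-P_{m-2}(\mu)]$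 for $m\geq0$. The operator is $$\mathcal{S}_{\mathrm{ref}\,\theta}^m\mathbf{\Phi}^m=c_{0\theta}\sum_{l=0}^mR^l(\varkappa_\theta,\mu_\theta)\Phi^{m-l},\quad m\geq1,$$ for $\Phi=\{\Phi^m\}_{m\geq0}\subset\mathbb{C}$ with $\Phi^0=0$, where $\mathbf{\Phi}^m=\{\Phi^l\}_{l=1}^m$. *)

(* Defs.v *)
From HB Require Import structures.
From mathcomp Require Export all_boot all_order all_algebra complex.
From mathcomp Require Export boolp classical_sets reals topology normedtype trigo.
From mathcomp Require Import ring lra.

Set Implicit Arguments.
Unset Strict Implicit.
Unset Printing Implicit Defensive.

Import Order.TTheory GRing.Theory Num.Theory ComplexField.
Local Open Scope classical_set_scope.
Local Open Scope complex_scope.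
Local Open Scope ring_scope.

(* The complex numbers are R[i] over R : realType. *)

(* The modulus as an element of R, unlike `|z| which lives in R[i]. *)
Definition cmod (R : realType) (z : R[i]) : R := Normc.normc z.

Definition expi (R : realType) (x : R) : R[i] := cos x +i* sin x.

Definition is_arg (R : realType) (z : R[i]) (phi : R) : Prop :=
  z = (cmod z)%:C * expi phi.

(* Arbitrary when z = 0; see arg0P and arg0_unique otherwise. *)
Definition arg0 (R : realType) (z : R[i]) : R :=
  xget 0 [set phi | 0 <= phi < 2 * pi /\ is_arg z phi].

(* The multivalued argument, with its determination indexed by k. *)
Definition arg (R : realType) (k : int) (z : R[i]) : R :=
  arg0 z + 2 * pi * k%:~R.

Definition a0_hat (R : realType) (hbar Binf Vinf : R) : R :=
  Vinf / (hbar ^+ 2 * Binf).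

Definition a1_hat (R : realType) (tau hbar rhoinf Binf : R) : R :=
  2 * rhoinf / (tau * hbar * Binf).

Definition a_hat (R : realType) (tau hbar rhoinf Binf Vinf : R) : R[i] :=
  a0_hat hbar Binf Vinf +i* a1_hat tau hbar rhoinf Binf.

(* In what follows a stands for a_hat, so that Re a is a0_hat. *)
Definition alpha_hat (R : realType) (theta h : R) (a : R[i]) : R[i] :=
  2 * a + ((1 - 4 * theta) * h ^+ 2)%:C * a ^+ 2.

Definition beta_hat (R : realType) (theta h : R) (a : R[i]) : R :=
  2 * complex.Re a + (1 - 4 * theta) * h ^+ 2 * cmod a ^+ 2.

Definition c0 (R : realType) (theta h : R) (a : R[i]) : R[i] :=
  - (Num.sqrt (cmod (alpha_hat theta h a)) / 2)%:C
    * expi (- (arg0 (alpha_hat theta h a) / 2)).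

Definition kappa (R : realType) (k : int) (theta h : R) (a : R[i]) : R[i] :=
  - expi (arg k (alpha_hat theta h a)).

Definition mu (R : realType) (theta h : R) (a : R[i]) : R :=
  beta_hat theta h a / cmod (alpha_hat theta h a).

(* Rodrigues' formula. *)
Definition legendre (R : realType) (n : nat) : {poly R} :=
  (2 ^+ n * n`!%:R)^-1 *: (('X^2 - 1) ^+ n)^`(n).

Definition legendre_ext (R : realType) (m : int) (x : R) : R :=
  match m with Posz n => (legendre R n).[x] | Negz _ => 0 end.

Definition Rker (R : realType) (m : nat) (kap : R[i]) (x : R) : R[i] :=
  - (kap ^+ m / (2 * m%:R - 1))
    * (legendre_ext m%:Z x - legendre_ext (m%:Z - 2) x)%:C.

(* Applied to sequences with Phi 0 = 0; only Phi 0, ..., Phi m are used. *)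
Definition Sref (R : realType) (k : int) (theta h : R) (a : R[i])
    (m : nat) (Phi : nat -> R[i]) : R[i] :=
  c0 theta h a *
  \sum_(l < m.+1) Rker l (kappa k theta h a) (mu theta h a) * Phi (m - l)%N.

Lemma is_argE (R : realType) (z : R[i]) (phi : R) : z != 0 ->
  is_arg z phi <-> cos phi = complex.Re z / cmod z /\ sin phi = complex.Im z / cmod z.
Proof.
move=> z0; have n0 : cmod z != 0.
  by apply: contra z0 => /eqP /Normc.eq0_normc ->.
rewrite /is_arg; move: (cmod z) n0 => n n0; case: z {z0} => x y /=.
rewrite /expi; split.
- case; rewrite !mul0r subr0 addr0 => -> ->.
  by rewrite ![n * _]mulrC !mulfK.
- case=> -> ->; congr (_ +i* _); rewrite mul0r ?subr0 ?addr0 mulrC divfK //.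
Qed.

Lemma cmod_sqr (R : realType) (z : R[i]) : cmod z ^+ 2 = complex.Re z ^+ 2 + complex.Im z ^+ 2.
Proof. by case: z => x y; rewrite sqr_sqrtr // addr_ge0 ?sqr_ge0. Qed.

Lemma arg0P (R : realType) (z : R[i]) : z != 0 ->
  0 <= arg0 z < 2 * pi /\ is_arg z (arg0 z).
Proof.
move=> z0; rewrite /arg0.
apply: (@xgetPex R 0 [set phi | 0 <= phi < 2 * pi /\ is_arg z phi]).
have n0 : cmod z != 0.
  by apply: contra z0 => /eqP /Normc.eq0_normc ->.
set c := complex.Re z / cmod z; set s := complex.Im z / cmod z.
have cs : c ^+ 2 + s ^+ 2 = 1.
  by rewrite !expr_div_n -mulrDl -cmod_sqr divff // expf_eq0.
have c1 : -1 <= c <= 1 by apply/andP; split; nra.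
have pi0 := pi_gt0 R.
have sE : sin (acos c) = `|s|.
  by rewrite sin_acos // -cs addrAC subrr add0r sqrtr_sqr.
have [s0|s0] := leP 0 s.
- exists (acos c); split.
    rewrite acos_ge0 //=; apply: (le_lt_trans (acos_lepi c1)); lra.
  by apply/(is_argE _ z0); rewrite sE (ger0_norm s0) acosK // in_itv.
- exists (- acos c + pi *+ 2); split.
    have lc1 : c < 1 by case/andP: c1 => _; rewrite le_eqVlt => /orP[/eqP e|//]; nra.
    have := @acos_gt0 R c; rewrite lc1 andbT; case/andP: (c1) => -> _ /(_ isT).
    have := acos_lepi c1; move=> h1 h2; apply/andP; split; lra.
  apply/(is_argE _ z0); rewrite cosD2pi sinD2pi cosN sinN sE (ltr0_norm s0) opprK.
  by rewrite acosK // in_itv.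
Qed.

Lemma arg0_unique (R : realType) (z : R[i]) (phi : R) : z != 0 ->
  0 <= phi < 2 * pi -> is_arg z phi -> phi = arg0 z.
Proof.
move=> z0 hp /(is_argE _ z0)[cp sp].
have [hq /(is_argE _ z0)[cq sq]] := arg0P z0.
move: (arg0 z) cq sq hq => psi; rewrite -cp -sp => cq sq hq {z z0 cp sp}.
have aux (x y : R) : 0 <= x < 2 * pi -> 0 <= y < 2 * pi ->
    cos x = cos y -> sin x = sin y -> ~~ (x < y).
  move=> /andP[x0 x2] /andP[y0 y2] cE sE; apply/negP => xy.
  have d1 : cos (y - x) = 1.
    rewrite cosB cE sE -!expr2; exact: cos2Dsin2.
  have : 0 < sin ((y - x) / 2).
    by apply: sin_gt0_pi; apply/andP; split; lra.
  have dE : y - x = (y - x) / 2 + (y - x) / 2 by field.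
  have := cos2Dsin2 ((y - x) / 2); move: d1; rewrite {1}dE cosD; nra.
by apply/eqP; rewrite eq_le !leNgt !aux.
Qed.

Lemma alpha_hat_neq0 (R : realType) (tau hbar rhoinf Binf Vinf theta h : R) :
  0 < tau -> 0 < hbar -> 0 < rhoinf -> 0 < Binf -> theta <= 1 / 4 ->
  alpha_hat theta h (a_hat tau hbar rhoinf Binf Vinf) != 0.
Proof.
move=> t0 b0 r0 B0 th; rewrite /a_hat.
have: 0 < a1_hat tau hbar rhoinf Binf by rewrite divr_gt0 ?mulr_gt0.
move: (a0_hat _ _ _) (a1_hat _ _ _ _) => x y y0.
have: 0 <= (1 - 4 * theta) * h ^+ 2.
  by apply: mulr_ge0; [lra | exact: sqr_ge0].
rewrite /alpha_hat; move: (_ * h ^+ 2) => g g0.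
apply/eqP; rewrite expr2 [2 * _]mulr_natl mulr2n; case.
rewrite !mul0r subr0 addr0 => e1 e2.
have gx : g * x = -1.
  have: y * (2 * (1 + g * x)) = 0 by rewrite -[RHS]e2; ring.
  by move/eqP; rewrite !mulf_eq0 (gt_eqF y0) pnatr_eq0 /= => /eqP; lra.
have : x = g * y ^+ 2.
  have : 2 * x + (g * x) * x - g * y ^+ 2 = 0 by rewrite -[RHS]e1; ring.
  by rewrite gx; lra.
nra.
Qed.

(* Main.v *)
Require Import Defs.
From mathcomp Require Import ring.

Set Implicit Arguments.
Unset Strict Implicit.
Unset Printing Implicit Defensive.

Import Order.TTheory GRing.Theory Num.Theory.
Local Open Scope complex_scope.
Local Open Scope ring_scope.

(** At [theta = 1/4] the factor [1 - 4 * theta] kills every term carrying [h], leaving [2 * a] for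
    [alpha_hat] and [2 * Re a] for [beta_hat]. Multiplying by 2 keeps [arg0] ([arg0Z]) and doubles
    the modulus ([cmodZ]), which gives the closed forms of [c0], [kappa] and [mu]. Since [Sref] sees
    [h] only through these three, it does not depend on [h]; nor on the determination of the
    argument, by periodicity of [expi]. *)

Lemma expiD2pi (R : realType) (x : R) (k : int) :
  expi (x + 2 * pi * k%:~R) = expi x.
Proof.
have nat_case (y : R) (n : nat) : expi (y + 2 * pi * n%:R) = expi y.
  elim: n => [|n IHn]; first by rewrite mulr0 addr0.
  rewrite -[RHS]IHn -(natr1 n).
  have -> : y + 2 * pi * (n%:R + 1) = y + 2 * pi * n%:R + pi *+ 2 by ring.
  by rewrite /expi cosD2pi sinD2pi.
case: k => n; first exact: nat_case.
(* For a negative integer, adding [n.+1] turns back on the left cancels the shift. *)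
rewrite -(nat_case _ n.+1) NegzE rmorphN /=; congr expi.
by rewrite -addrA mulrN addNr addr0.
Qed.

Lemma cmodZ (R : realType) (r : R) (z : R[i]) :
  0 <= r -> cmod (r%:C * z) = r * cmod z.
Proof.
by move=> r0; rewrite /cmod Normc.normcM /= expr0n addr0 sqrtr_sqr ger0_norm.
Qed.

(** [arg0 z] lies in [[0, 2 pi)] and is also an argument of [r z], so uniqueness applies. *)
Lemma arg0Z (R : realType) (r : R) (z : R[i]) :
  0 < r -> z != 0 -> arg0 (r%:C * z) = arg0 z.
Proof.
move=> r0 z0; have [bounds argz] := arg0P z0.
apply/esym/arg0_unique => //.
  by rewrite mulf_neq0 // fmorph_eq0 gt_eqF.
by rewrite /is_arg cmodZ ?ltW // rmorphM /= -mulrA -argz.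
Qed.

Lemma alpha_hat_quarter (R : realType) (h : R) (a : R[i]) :
  alpha_hat (1 / 4) h a = 2%:C * a.
Proof.
have e : 1 - 4 * (1 / 4) = 0 :> R by field.
by rewrite /alpha_hat e mul0r rmorph0 mul0r addr0 rmorph_nat.
Qed.

Lemma c0_quarter (R : realType) (h : R) (a : R[i]) : a != 0 ->
  c0 (1 / 4) h a = - (Num.sqrt (cmod a / 2))%:C * expi (- (arg0 a / 2)).
Proof.
move=> a0; rewrite /c0 alpha_hat_quarter arg0Z // cmodZ //.
congr (- _%:C * _).
(* A square is split off so that the root releases a factor 2, cancelling the denominator in
   [c0]. *)
rewrite (_ : 2 * cmod a = 2 ^+ 2 * (cmod a / 2)); last by field.
rewrite sqrtrM ?sqr_ge0 // sqrtr_sqr ger0_norm //.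
by field.
Qed.

(** The determinations [k] and [l] are unrelated, so any two values of [kappa] can be brought to one
    common form. *)
Lemma kappa_quarter (R : realType) (k l : int) (h : R) (a : R[i]) : a != 0 ->
  kappa k (1 / 4) h a = - expi (arg l a).
Proof.
by move=> a0; rewrite /kappa alpha_hat_quarter /arg !expiD2pi arg0Z.
Qed.

Lemma mu_quarter (R : realType) (h : R) (a : R[i]) :
  mu (1 / 4) h a = complex.Re a / cmod a.
Proof.
have e : 1 - 4 * (1 / 4) = 0 :> R by field.
rewrite /mu /beta_hat alpha_hat_quarter cmodZ // e !mul0r addr0.
by rewrite -mulf_div divff ?mul1r // pnatr_eq0.
Qed.

Theorem corollary4 (R : realType) (tau hbar rhoinf Binf Vinf : R)
    (htau : 0 < tau) (hhbar : 0 < hbar) (hrho : 0 < rhoinf) (hB : 0 < Binf) :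
  let a := a_hat tau hbar rhoinf Binf Vinf in
  (forall (h1 h2 : R) (k1 k2 : int), 0 < h1 -> 0 < h2 ->
     forall (m : nat) (Phi : nat -> R[i]), (1 <= m)%N -> Phi 0%N = 0 ->
       Sref k1 (1 / 4) h1 a m Phi = Sref k2 (1 / 4) h2 a m Phi) /\
  (forall h : R, 0 < h ->
     [/\ c0 (1 / 4) h a
           = - (Num.sqrt (cmod a / 2))%:C * expi (- (arg0 a / 2)),
         forall k1 k2 : int, kappa k1 (1 / 4) h a = - expi (arg k2 a)
       & mu (1 / 4) h a = a0_hat hbar Binf Vinf / cmod a]).
Proof.
move=> a; have a0 : a != 0.
  (* Nonvanishing of [a] is read off from that of [alpha_hat], which is [2 * a] here; [h = 0] is an
     arbitrary choice. *)
  have le_quarter : (1 / 4 : R) <= 1 / 4 by [].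
  have := alpha_hat_neq0 Vinf 0 htau hhbar hrho hB le_quarter.
  by rewrite alpha_hat_quarter mulf_eq0 negb_or => /andP[].
split=> [h1 h2 k1 k2 _ _ m Phi _ _|h _].
  (* Both sides are normalised to the determination 0. *)
  by rewrite /Sref !c0_quarter // !mu_quarter !(kappa_quarter _ 0).
split; [exact: c0_quarter|by move=> k1 k2; apply: kappa_quarter|].
exact: mu_quarter.
Qed.
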